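(* Let $G$ be a non-discrete locally profinite group and let $K\subset G$ be a profinite open subgroup. Let $\mathcal{S}(G)$ be the Chabauty space of closed subgroups of $G$. Then the pair $(G,K)$ is fair if and only if $$\overline{\{gKg^{-1}: g\in G\}}\subset\{\text{non-discrete closed subgroups of } G\},$$ where the closure is taken in $\mathcal{S}(G)$.
   Context: A locally profinite group is a topological group having an open subgroup which is profinite in the induced topology. Definition (fair): the pair $(G,K)$ is fair if for every open subgroup $H\subset K$ there is an open subgroup $H'\subset K$ such that for all $g\in G$ one has a strict inclusion $K\cap gH'g^{-1}\subsetneq K\cap gHg^{-1}$. $\mathcal{S}(G)$ is the set of all closed subgroups of $G$ equipped with the Chabauty topology, i.e. the topology generated by the sets $\{D\in\mathcal{S}(G): D\cap Q=\varnothing\}$ for $Q\subset G$ compact and $\{D\in\mathcal{S}(G): D\cap O\neq\varnothing\}$ for $O\subset G$ open; it is a compact Hausdorff space. *)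

(* Defs.v *)
From HB Require Import structures.
From mathcomp Require Import all_boot.
From mathcomp Require Import boolp classical_sets topology.

Set Implicit Arguments.
Unset Strict Implicit.
Unset Printing Implicit Defensive.

Local Open Scope group_scope.
Local Open Scope classical_set_scope.

HB.mixin Record isTopologicalGroup G of Topological G & Group G := {
  mulg_continuous : continuous (fun x : G * G => x.1 * x.2);
  invg_continuous : continuous (fun x : G => x^-1)
}.

#[short(type="topologicalGroupType")]
HB.structure Definition TopologicalGroup :=
  {G of Topological G & Group G & isTopologicalGroup G}.

(* The content of the mixin Discrete_ofNbhs of discrete_topology.v, as a Prop *)
Definition discrete_space (T : topologicalType) : Prop :=
  @nbhs T T = @principal_filter T.

Definition profinite_space (T : topologicalType) : Prop :=
  [/\ compact [set: T], hausdorff_space T & totally_disconnected [set: T]].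

Section TopologicalGroupDefs.
Variable G : topologicalGroupType.
Implicit Types (g : G) (H K : set G).

Definition subgroup H : Prop := group_closed (mem H).

Definition locally_profinite : Prop :=
  exists U : set G, [/\ subgroup U, open U & profinite_space (set_type U)].

Definition conj_set g H : set G := [set g * h * g^-1 | h in H].

Definition fair K : Prop :=
  forall H, subgroup H -> open H -> H `<=` K ->
  exists H', [/\ subgroup H', open H', H' `<=` K &
    forall g, K `&` conj_set g H' `<` K `&` conj_set g H].

Record closed_subgroup : Type := ClosedSubgroup {
  closed_subgroup_set :> set G;
  closed_subgroupP : subgroup closed_subgroup_set;
  closed_subgroup_closed : closed closed_subgroup_set
}.

HB.instance Definition _ := gen_eqMixin closed_subgroup.
HB.instance Definition _ := gen_choiceMixin closed_subgroup.

Definition chabauty_subbase : set (set closed_subgroup) :=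
  [set [set D : closed_subgroup | D `&` Q = set0] | Q in @compact G] `|`
  [set [set D : closed_subgroup | D `&` O !=set0] | O in @open G].

HB.instance Definition _ :=
  isSubBaseTopological.Build closed_subgroup chabauty_subbase id.

Definition conj_orbit K : set closed_subgroup :=
  [set D | exists g, conj_set g K = D].

Lemma mulgl_continuous g : continuous (fun x : G => g * x).
Proof.
move=> x; apply: (@continuous_comp _ _ _ (fun y : G => (g, y))
  (fun y : G * G => y.1 * y.2)); last exact: mulg_continuous.
by apply: cvg_pair; [exact: cvg_cst|exact: cvg_id].
Qed.

Lemma mulgr_continuous g : continuous (fun x : G => x * g).
Proof.
move=> x; apply: (@continuous_comp _ _ _ (fun y : G => (y, g))
  (fun y : G * G => y.1 * y.2)); last exact: mulg_continuous.
by apply: cvg_pair; [exact: cvg_id|exact: cvg_cst].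
Qed.

Lemma open_subgroup_closed H : subgroup H -> open H -> closed H.
Proof.
move=> sH oH x clx.
have sV := group_closedV sH; have sM := group_closedM sH.
have [|y [Hy /= Hxy]] := clx [set y | H (x^-1 * y)].
  have := open_comp (fun y _ => @mulgl_continuous x^-1 y) oH.
  move=> o; apply: open_nbhs_nbhs; split; first exact: o.
  by rewrite /= mulVg; case: sH => /set_mem.
suff -> : x = y * (x^-1 * y)^-1.
  by apply/set_mem/sM; [|apply: sV]; exact: mem_set.
by rewrite invgM invgK mulgA mulgV mul1g.
Qed.

Lemma conj_setE g H : conj_set g H = [set x | H (g^-1 * x * g)].
Proof.
apply/seteqP; split=> [_ [h Hh <-]/=|x /= Hx].
  by rewrite !mulgA mulVg mul1g -mulgA mulVg mulg1.
by exists (g^-1 * x * g) => //; rewrite !mulgA mulgV mul1g -mulgA mulgV mulg1.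
Qed.

Lemma conj_subgroup g H : subgroup H -> subgroup (conj_set g H).
Proof.
move=> [H1 HF]; rewrite conj_setE; split=> [|u v]; rewrite !inE/=.
  by rewrite mulg1 mulVg; exact/set_mem.
move=> Hu Hv; have := HF _ _ (mem_set Hu) (mem_set Hv); rewrite inE.
by rewrite !invgM invgK !mulgA -(mulgA _ g g^-1) mulgV mulg1.
Qed.

Lemma conj_closed g H : closed H -> closed (conj_set g H).
Proof.
rewrite conj_setE => cH.
apply: (@closed_comp _ _ (fun x : G => g^-1 * x * g)) => // x _.
apply: (@continuous_comp _ _ _ (fun y : G => g^-1 * y) (fun y : G => y * g)).
  exact: mulgl_continuous.
exact: mulgr_continuous.
Qed.

(* No conjugate is lost in conj_orbit: each is the underlying set of some D. *)
Lemma conj_orbit_full K : subgroup K -> open K ->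
  forall g, exists2 D : closed_subgroup, conj_orbit K D & conj_set g K = D.
Proof.
move=> sK oK g; have cK := open_subgroup_closed sK oK.
by exists (ClosedSubgroup (conj_subgroup g sK) (conj_closed cK)) => //; exists g.
Qed.

End TopologicalGroupDefs.

Arguments locally_profinite : clear implicits.

(* Main.v *)
Require Import Defs.
From HB Require Import structures.
From mathcomp Require Import all_boot.
From mathcomp Require Import boolp classical_sets topology.
From mathcomp Require Import functions.

(* A closed subgroup D is discrete iff it meets some open subgroup H of K (these
   form a base at 1) only in 1.

   Conjugating by g^-1, fairness says that for each H there is H' such that
   every conjugate L of K satisfies L `&` H' `<` L `&` H, hence meets the compact
   set H `\` H'. If D in the closure had D `&` H = {1}, missing H `\` H' would be
   a Chabauty neighbourhood of D containing no conjugate of K.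

   Conversely, if fairness fails at H, then for every open subgroup V of H some
   conjugate L of K has L `&` H `<=` V. The Chabauty space being compact, these
   conjugates accumulate, as V shrinks, at some D with D `&` H = {1}. *)

Local Open Scope classical_set_scope.

(** * Zero-dimensionality of profinite spaces *)

Section TopologicalSpace.
Set Implicit Arguments.
Unset Strict Implicit.

(** Otherwise the sets [D]\[W], for [D] clopen around [x], generate a proper filter. A cluster point
    of it lies in every such [D], hence in the open set [W], although the filter contains the
    complement of [W]. *)
Lemma clopen_nbhs_sub_open (T : topologicalType) (x : T) (W : set T) :
  compact [set: T] -> open W ->
  (forall z, (forall D, clopen D -> D x -> D z) -> W z) ->
  exists D, [/\ clopen D, D x & D `<=` W].
Proof.
move=> cT oW QW; apply: contrapT => nD.
pose F := filter_from [set D : set T | clopen D /\ D x] (fun D => D `\` W).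
have FF : ProperFilter F.
  apply: filter_from_proper.
    apply: filter_from_filter; first by exists setT; split => //; exact: clopenT.
    move=> A B [cA Ax] [cB Bx]; exists (A `&` B); first by split=> //; exact: clopenI.
    by move=> z [[Az Bz] nW]; split.
  move=> D [cD Dx]; apply: contrapT => /nonemptyPn DW0; apply: nD.
  by exists D; split=> // z Dz; apply: contrapT => nWz; have : set0 z; rewrite // -DW0.
have [z [_ clz]] := cT F FF (filterT (F := F)).
have Wz : W z.
  apply: QW => D cD Dx; have [_ clD] := cD; apply: clD => N nN.
  have FD : F D by exists D => // w [].
  exact: clz FD nN.
have FW : F (~` W).
  by exists setT; [split => //; exact: clopenT | move=> w []].
by have [w []] := clz _ _ FW (open_nbhs_nbhs (conj oW Wz)).
Qed.

(* In a compact Hausdorff space the quasi-component of a point is connected. *)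
Lemma profinite_zero_dimensional (T : topologicalType) :
  profinite_space T -> zero_dimensional T.
Proof.
move=> [cT hT tdT] x y xy; apply: contrapT => nU.
pose Q := [set z : T | forall D, clopen D -> D x -> D z].
have Qx : Q x by [].
have Qy : Q y.
  by move=> D cD Dx; apply: contrapT => Dy; apply: nU; exists D.
have clQ : closed Q.
  move=> z clz D cD Dx; have [_] := cD; apply=> N /clz [w [Qw Nw]].
  by exists w; split=> //; exact: Qw.
suff cQ : connected Q.
  have : connected_component setT x y by exists Q.
  by rewrite tdT // => yx; move: xy; rewrite yx eqxx.
move=> B [b Bb] [C1 oC1 BC1] [C2 cC2 BC2].
(* [A] is the complement of [B] in [Q]. Both are closed, so normality gives [N] around [B] whose
   closure misses [A]. *)
pose A := Q `&` ~` C1.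
have clA : closed A by apply: closedI => //; exact: open_closedC.
have clB : closed B by rewrite BC2; exact: closedI.
have nAB : set_nbhs B (~` A).
  move=> z Bz; apply: open_nbhs_nbhs; split; first exact: closed_openC.
  by move: Bz; rewrite BC1 => -[Qz C1z] [].
have [N BN clNA] := compact_normal hT cT clB nAB.
have BNi : B `<=` N° by move=> z /BN.
have ANc z : A z -> ~ closure N z by move=> Az /clNA.
have oW : open (N° `|` ~` closure N).
  by apply: openU; [exact: open_interior | exact/closed_openC/closed_closure].
have QAB z : Q z -> A z \/ B z.
  by rewrite BC1 => Qz; have [?|?] := pselect (C1 z); [right|left].
have QW z : Q z -> (N° `|` ~` closure N) z.
  by move=> /QAB[/ANc|/BNi]; [right|left].
have [D [[oD cD] Dx DW]] := clopen_nbhs_sub_open cT oW QW.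
have NiN : N° `<=` closure N.
  by apply: subset_trans (@subset_closure _ N); exact: interior_subset.
(* [D] avoids the boundary of [N], so [N°] cuts it into two clopen pieces. The piece containing [x]
   contains all of [Q]: if it is the inner one then [A] is empty, and it cannot be the outer one
   because [b] lies in [N°]. *)
have clp : clopen (D `&` N°).
  split; first by apply: openI => //; exact: open_interior.
  rewrite (_ : _ `&` _ = D `&` closure N); first by apply: closedI => //; exact: closed_closure.
  apply/seteqP; split=> z [Dz Nz]; split=> //; first exact: NiN.
  by case: (DW z Dz).
have clp' : clopen (D `&` ~` N°).
  split; last by apply: closedI => //; exact/open_closedC/open_interior.
  rewrite (_ : _ `&` _ = D `&` ~` closure N).
    by apply: openI => //; exact/closed_openC/closed_closure.
  apply/seteqP; split=> z [Dz Nz]; split=> //; first by case: (DW z Dz).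
  by move=> /NiN.
have [Nx|Nx] := pselect (N° x).
  apply/seteqP; split=> [z|z Qz]; first by rewrite BC1 => -[].
  have [Az|//] := QAB z Qz.
  by have [_ /NiN /(ANc z Az)] := Qz _ clp (conj Dx Nx).
have Qb : Q b by move: Bb; rewrite BC1 => -[].
by have [_ []] := Qb _ clp' (conj Dx Nx); exact: BNi.
Qed.

End TopologicalSpace.

Section TopologicalGroup.
Set Implicit Arguments.
Unset Strict Implicit.
Variable G : topologicalGroupType.
Implicit Types (g x y : G) (H K V : set G).
Local Open Scope group_scope.

(** * Open subgroups and van Dantzig's theorem *)

Lemma subgroupP H : subgroup H <->
  [/\ H 1, (forall x y, H x -> H y -> H (x * y)) & (forall x, H x -> H x^-1)].
Proof.
split=> [sH|[H1 HM HV]].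
  split; first by case: sH => /set_mem.
    by move=> x y /mem_set Hx /mem_set Hy; apply/set_mem/(group_closedM sH).
  by move=> x /mem_set Hx; apply/set_mem/(group_closedV sH).
by split=> [|x y /set_mem Hx /set_mem Hy]; apply/mem_set => //; exact/HM/HV.
Qed.

Lemma subgroupI H K : subgroup H -> subgroup K -> subgroup (H `&` K).
Proof.
move=> /subgroupP[H1 HM HV] /subgroupP[K1 KM KV]; apply/subgroupP; split=> //.
  by move=> x y [? ?] [? ?]; split; [exact: HM|exact: KM].
by move=> x [? ?]; split; [exact: HV|exact: KV].
Qed.

Lemma open_subgroup_nbhs1 H : subgroup H -> nbhs (1 : G) H -> open H.
Proof.
move=> /subgroupP[H1 HM HV] nH; rewrite openE => x Hx; rewrite /interior /=.
have c : (fun y : G => x^-1 * y) @ x --> (1 : G).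
  by rewrite -[X in _ --> X](mulVg x); exact: mulgl_continuous.
have : nbhs x [set y | H (x^-1 * y)] by exact: c nH.
apply: filterS => y /= Hy.
by rewrite -(mulVKg x y); exact: HM.
Qed.

(* The stabiliser of V under right translation lies in V, and the tube lemma
   makes it a neighbourhood of 1. *)
Lemma compact_open_subgroup V : compact V -> open V -> V 1 ->
  exists H, [/\ subgroup H, open H & H `<=` V].
Proof.
move=> cV oV V1; pose S x := V `<=` [set v | V (v * x)].
have SM x y : S x -> S y -> S (x * y).
  by move=> Sx Sy v Vv; rewrite /= mulgA; apply/Sy/Sx.
have nS : \forall x \near (1 : G), S x.
  move/compact_near_coveringP : cV => /(_ _ (nbhs (1 : G)) (fun x v => V (v * x))).
  apply => v Vv.
  have /(_ V) := mulg_continuous (v, 1 : G).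
  by apply; rewrite /= mulg1; exact: open_nbhs_nbhs.
have nSV : \forall x \near (1 : G), S x^-1.
  have /(_ [set x | S x]) := invg_continuous (1 : G); rewrite invg1; exact.
(* [S] is stable under products; imposing it on [x^-1] as well gives inverses. *)
have sH : subgroup [set x | S x /\ S x^-1].
  apply/subgroupP; split => /=.
  - by rewrite invg1; split=> v; rewrite /= mulg1.
  - by move=> x y [? ?] [? ?]; rewrite invgM; split; exact: SM.
  - by move=> x [? ?]; rewrite invgK.
exists [set x | S x /\ S x^-1]; split=> //.
  by apply: open_subgroup_nbhs1 => //; exact: filterI.
by move=> x [/(_ 1 V1)]; rewrite /= mul1g.
Qed.

Lemma image_set_valT K : set_val @` [set: set_type K] = K.
Proof.
apply/seteqP; split=> [_ [[x Kx] _ <-]|x Kx]; first exact: set_mem.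
by exists (SigSub (mem_set Kx)).
Qed.

Lemma set_val_continuous K : continuous (set_val : set_type K -> G).
Proof. exact: initial_continuous. Qed.

Lemma set_val_compact K (C : set (set_type K)) : compact C -> compact (set_val @` C).
Proof.
by apply: continuous_compact; apply: continuous_subspaceT; exact: set_val_continuous.
Qed.

Lemma set_val_open K (C : set (set_type K)) : open K -> open C -> open (set_val @` C).
Proof.
move=> oK [U oU <-]; rewrite (_ : _ @` _ = U `&` K); first exact: openI.
apply/seteqP; split=> [_ [[x Kx] Ux <-]|x [Ux Kx]]; first by split=> //; exact: set_mem.
by exists (SigSub (mem_set Kx)).
Qed.

Lemma profinite_compact K : profinite_space (set_type K) -> compact K.
Proof. by move=> [cK _ _]; rewrite -(image_set_valT K); exact: set_val_compact. Qed.

(** By zero-dimensionality, [1] has a clopen neighbourhood in [K] inside [U]. Its image in [G] is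
    compact and open, so it contains an open subgroup. *)
Lemma van_dantzig K U : open K -> K 1 -> profinite_space (set_type K) ->
  nbhs (1 : G) U ->
  exists H, [/\ subgroup H, open H & H `<=` K `&` U].
Proof.
move=> oK K1 pK nU; have [cK hK tK] := pK.
pose e : set_type K := SigSub (mem_set K1).
have nU' : nbhs e (set_val @^-1` U) by apply: set_val_continuous.
have [C [Ce [oC clC]] CU] := zero_dimensional_cvg hK (profinite_zero_dimensional pK) cK nU'.
have [| | |H [sH oH HC]] := @compact_open_subgroup (set_val @` C).
- by apply: set_val_compact; exact: subclosed_compact cK _.
- exact: set_val_open.
- by exists e.
exists H; split=> // x /HC [[y Ky] Cy <-]; split; first exact: set_mem.
exact: CU Cy.
Qed.

(** * Discreteness of a subgroup, read off at the identity *)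

(** The left translate of [H] by a point [x] of [D] isolates [x] in [D]. *)
Lemma subgroup_discrete (D H : set G) : subgroup D -> open H -> H 1 ->
  D `&` H `<=` [set 1] -> discrete_space (set_type D).
Proof.
move=> /subgroupP[D1 DM DV] oH H1 DH; apply/funext=> -[x Dx].
apply/seteqP; split=> A; first by move/nbhs_singleton/principal_filterP.
move/principal_filterP => Ax.
exists (set_val @^-1` [set y | H (x^-1 * y)]); split.
- by exists [set y | H (x^-1 * y)] => //; apply: open_comp oH => y _; exact: mulgl_continuous.
- by rewrite /= mulVg.
move=> [y Dy] /= Hxy; have Dx' := set_mem Dx; have Dy' := set_mem Dy.
have xy : x^-1 * y = 1 by apply: DH; split=> //; exact/DM/Dy'/DV.
have yx : y = x by rewrite -(mulVKg x y) xy mulg1.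
by subst y; rewrite (bool_irrelevance Dy Dx).
Qed.

Lemma discrete_subgroup_nbhs1 (D : set G) : D 1 -> discrete_space (set_type D) ->
  exists2 U, nbhs (1 : G) U & D `&` U `<=` [set 1].
Proof.
move=> D1 dD; pose e : set_type D := SigSub (mem_set D1).
have : nbhs e [set e] by rewrite dD; exact/principal_filterP.
move=> [_ [[U oU <-] /= Ue] Us]; exists U; first exact: open_nbhs_nbhs.
by move=> x [Dx Ux]; have /(congr1 val) /= := Us (SigSub (mem_set Dx)) Ux.
Qed.

(** * The Chabauty topology and its compactness *)

Lemma chabauty_open_subbase (A : set (closed_subgroup G)) :
  chabauty_subbase A -> open A.
Proof.
move=> bA; exists [set A]; last by rewrite bigcup_set1.
by move=> _ ->; exact: (finI_from1 id bA).
Qed.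

Lemma chabauty_open_miss (Q : set G) : compact Q ->
  open [set D : closed_subgroup G | D `&` Q = set0].
Proof. by move=> cQ; apply: chabauty_open_subbase; left; exists Q. Qed.

Lemma chabauty_open_hit (O : set G) : open O ->
  open [set D : closed_subgroup G | D `&` O !=set0].
Proof. by move=> oO; apply: chabauty_open_subbase; right; exists O. Qed.

(** Testing subbasic sets is enough, because a filter is stable under finite intersections. *)
Lemma chabauty_cvg (F : set_system (closed_subgroup G)) (D : closed_subgroup G) :
  Filter F -> (forall A, chabauty_subbase A -> A D -> F A) -> F --> D.
Proof.
move=> FF FD A [_ [[I IB <-] [B IB_B BD] BA]].
have [E EB BE] := IB _ IB_B.
apply: (@filterS _ F _ B); first by move=> x Bx; apply: BA; exists B.
rewrite /= -BE; apply: filter_bigI => C CE.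
apply: FD; first exact: set_mem (EB C CE).
by move: BD; rewrite /= -BE; exact.
Qed.

(* The limit consists of the points all of whose neighbourhoods are met by
   F-almost every subgroup. *)
Lemma chabauty_compact : compact [set: closed_subgroup G].
Proof.
rewrite compact_ultra => F FU _; have FF : Filter F by exact: ultra_proper.
pose hit (U : set G) := [set E : closed_subgroup G | E `&` U !=set0].
pose L := [set x : G | forall U, nbhs x U -> F (hit U)].
have sL : subgroup L.
  apply/subgroupP; split.
  - move=> U nU; apply: (@filterS _ F _ setT); last exact: filterT.
    move=> E _; exists 1; split; last exact: nbhs_singleton.
    by have /subgroupP[] := closed_subgroupP E.
  - move=> x y Lx Ly U nU.
    have [[V W] /= [nV nW] VW] := @mulg_continuous G (x, y) U nU.
    have := @filterI _ F FF _ _ (Lx V nV) (Ly W nW); apply: (@filterS _ F FF).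
    move=> E [[v [Ev Vv]] [w [Ew Ww]]]; exists (v * w); split.
      by have /subgroupP[_ M _] := closed_subgroupP E; exact: M.
    exact: (VW (v, w)).
  - move=> x Lx U nU; have := Lx _ (@invg_continuous G x U nU); apply: (@filterS _ F FF).
    move=> E [v [Ev Uv]]; exists v^-1; split => //.
    by have /subgroupP[_ _ V] := closed_subgroupP E; exact: V.
have cL : closed L.
  move=> x clx U; rewrite nbhsE => -[V [oV Vx] VU].
  have [y [Ly Vy]] := clx V (open_nbhs_nbhs (conj oV Vx)).
  have := Ly V (open_nbhs_nbhs (conj oV Vy)); apply: (@filterS _ F FF).
  by move=> E [z [Ez Vz]]; exists z; split=> //; exact: VU.
exists (ClosedSubgroup sL cL); split=> //; apply: chabauty_cvg => A [[Q cQ <-]|[O oO <-]] /=.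
  (* A point of [Q] is outside [L], so it has a neighbourhood [U] with [hit U] not in [F]; as [F] is
     an ultrafilter, almost every [E] misses [U]. Compactness of [Q] makes this uniform over [Q]. *)
  move=> LQ; move/compact_near_coveringP : cQ.
  move=> /(_ _ F (fun E x => ~ closed_subgroup_set E x)) H.
  have : \forall E \near F, Q `<=` [set x | ~ closed_subgroup_set E x].
    apply: H => x Qx; have nLx : ~ L x.
      by move=> Lx; have : set0 x; rewrite // -LQ.
    have [U /not_implyP[nU nFU]] : exists U, ~ (nbhs x U -> F (hit U)).
      exact/existsNP.
    have FU' : F (~` hit U) by have [] := in_ultra_setVsetC (hit U) FU.
    exists (U, ~` hit U) => //= -[y E] [/= Uy nE] Ey.
    by apply: nE; exists y.
  apply: filterS => E QE; apply/seteqP; split=> // x [Ex Qx].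
  exact: QE Qx Ex.
by move=> [x [Lx Ox]]; exact: Lx (open_nbhs_nbhs (conj oO Ox)).
Qed.

(** * Fairness against limits of conjugates *)

Lemma conj_set_conjP g H x : conj_set g H (g * x * g^-1) <-> H x.
Proof. by rewrite conj_setE /= !mulgA mulVg mul1g -mulgA mulVg mulg1. Qed.

Lemma conj_setVP g H x : conj_set g^-1 H x <-> H (g * x * g^-1).
Proof. by rewrite conj_setE /= invgK. Qed.

Lemma fair_nondiscrete K : subgroup K -> open K -> profinite_space (set_type K) ->
  fair K ->
  closure (conj_orbit K) `<=` [set D : closed_subgroup G | ~ discrete_space (set_type D)].
Proof.
move=> sK oK pK fK D clD /= dD.
have /subgroupP[K1 _ _] := sK.
have /subgroupP[D1 _ _] := closed_subgroupP D.
have [U nU DU] := discrete_subgroup_nbhs1 D1 dD.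
have [H [sH oH HKU]] := van_dantzig oK K1 pK nU.
have [|H' [sH' oH' H'K KH']] := fK H sH oH; first by move=> x /HKU[].
have /subgroupP[H'1 _ _] := sH'.
have cQ : compact (H `\` H').
  apply: subclosed_compact (profinite_compact pK) _; last by move=> x [/HKU[]].
  by apply: closedI; [exact: open_subgroup_closed | exact: open_closedC].
have DQ : D `&` (H `\` H') = set0.
  apply/seteqP; split=> // x [Dx [Hx]]; apply.
  by rewrite (DU x) //; split=> //; have [] := HKU x Hx.
have [E [[g gE] EQ]] := clD _ (open_nbhs_nbhs (conj (chabauty_open_miss cQ) DQ)).
(* Strictness at [g^-1] gives [x] in [K] with [g * x * g^-1] in [H]\[H']; this conjugate also lies
   in [E], the conjugate of [K] by [g]. *)
have [_ /existsNP[x /not_implyP[[Kx Hx] nx]]] := KH' g^-1.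
have : set0 (g * x * g^-1).
  rewrite -EQ -gE; split; first exact/conj_set_conjP.
  split; first exact/conj_setVP.
  by move=> H'x; apply: nx; split=> //; exact/conj_setVP.
by [].
Qed.

Lemma nondiscrete_fair K : subgroup K -> open K -> profinite_space (set_type K) ->
  closure (conj_orbit K) `<=` [set D : closed_subgroup G | ~ discrete_space (set_type D)] ->
  fair K.
Proof.
move=> sK oK pK nd H sH oH HK; apply: contrapT => nH.
have /subgroupP[K1 _ _] := sK.
have /subgroupP[H1 _ _] := sH.
pose small (V : set G) := [set E : closed_subgroup G | conj_orbit K E /\ E `&` H `<=` V].
pose nb := [set V | subgroup V /\ open V /\ V `<=` H].
pose F := filter_from nb small.
have FF : ProperFilter F.
  apply: filter_from_proper.
    apply: filter_from_filter; first by exists H; split=> //; split.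
    move=> A B [sA [oA AH]] [sB [oB BH]]; exists (A `&` B).
      split; first exact: subgroupI.
      by split; [exact: openI | move=> x [/AH]].
    by move=> E [EK EAB]; split; split=> // x /EAB[].
  move=> V [sV [oV VH]].
  (* The inclusion is automatic from [V]<=[H], so what fails at [g] is strictness. Conjugating the
     resulting equality by [g^-1] puts the conjugate of [K] by [g^-1] in [small V]. *)
  have /existsNP[g nlt] : ~ forall g, K `&` conj_set g V `<` K `&` conj_set g H.
    by move=> lt; apply: nH; exists V; split=> // x /VH/HK.
  have [E EK gE] := conj_orbit_full sK oK g^-1.
  exists E; split=> // x; rewrite -gE => -[/conj_setVP Kx Hx].
  apply: contrapT => nVx; apply: nlt; split.
    move=> y [Ky]; rewrite !conj_setE /= => /VH; split=> //.
  move=> /(_ (g * x * g^-1))[]; first by split=> //; exact/conj_set_conjP.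
  by move=> _ /conj_set_conjP.
have [D [_ clD]] := chabauty_compact FF (filterT (F := F)).
have : closure (conj_orbit K) D.
  move=> N nN; have : F (conj_orbit K) by exists H => [|E []] //; split=> //; split.
  by move=> FK; exact: clD FK nN.
move=> /nd; apply; apply: (subgroup_discrete (closed_subgroupP D) oH H1).
(* A point [x] other than [1] in [D]&[H] is separated from [1] by a clopen subset of [K], which
   yields an open subgroup [V] of [H] missing [x]. *)
move=> x [Dx Hx]; apply: contrapT => /= x1.
have Kx := HK x Hx.
have [|C [[oC _] C1 Cx]] := profinite_zero_dimensional pK
    (x := SigSub (mem_set K1)) (y := SigSub (mem_set Kx)).
  by apply/eqP => /(congr1 val) /= e1; exact: x1.
have nU : nbhs (1 : G) (set_val @` C `&` H).
  apply: open_nbhs_nbhs; split; first by apply: openI => //; exact: set_val_open.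
  by split=> //; exists (SigSub (mem_set K1)).
have [V [sV oV VU]] := van_dantzig oK K1 pK nU.
have nVx : ~ V x.
  move=> /VU[_ [[u Cu ux] _]]; apply: Cx.
  by rewrite (_ : SigSub _ = u) //; exact/val_inj/esym.
have FV : F (small V) by exists V => //; split=> //; split=> // y /VU[_ []].
(* [V], being an open subgroup, is closed. Hitting [H]\[V] is then an open condition, satisfied by
   [D] at [x] but by no member of [small V]. *)
have oHV : open (H `\` V).
  by apply: openI => //; apply: closed_openC; exact: open_subgroup_closed.
have DHV : D `&` (H `\` V) !=set0 by exists x.
have [E [[_ EV] [y [Ey [Hy]]]]] :=
  clD _ _ FV (open_nbhs_nbhs (conj (chabauty_open_hit oHV) DHV)).
by apply; exact: EV.
Qed.

End TopologicalGroup.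

Theorem proposition7p1 (G : topologicalGroupType) (K : set G)
  (G_nondiscrete : ~ discrete_space G) (G_locally_profinite : locally_profinite G)
  (K_subgroup : subgroup K) (K_open : open K) (K_profinite : profinite_space (set_type K)) :
  fair K <->
  closure (conj_orbit K) `<=` [set D : closed_subgroup G | ~ discrete_space (set_type D)].
Proof.
by split; [exact: fair_nondiscrete|exact: nondiscrete_fair].
Qed.
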